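(* Let $d, n \in \mathbb{N}$ (with $d,n\ge 1$), let $X \subseteq \mathbb{R}^d$ be a nonempty compact (not necessarily convex) set, let $\Sigma \in \mathbb{R}^{d\times d}$ be a symmetric positive definite matrix, and let $F(x,\xi) = \xi^T x$. Consider the statistical decision problem in which the state of nature is $\mu \in \mathbb{R}^d$, the data are $n$ i.i.d. samples $\xi^1,\ldots,\xi^n \sim N(\mu,\Sigma)$, the action set is $X$, and the loss is $\mathcal{L}(\mu,x) = \mu^T x - \min_{z\in X}\mu^T z$. Let $\delta^n_{SA}$ be a sample average decision rule, i.e., a decision rule satisfying $$\delta^n_{SA}(\xi^1,\ldots,\xi^n) \in \arg\min\{\overline{\xi}^T x : x \in X\}, \qquad \overline{\xi} := \frac1n\sum_{i=1}^n \xi^i,$$ for all $(\xi^1,\ldots,\xi^n)\in(\mathbb{R}^d)^n$. Then $\delta^n_{SA}$ is admissible within $\Delta^n$.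
   Context: Underlying stochastic optimization problem: $\min_{x\in X}\{f_\mu(x) := \mathbb{E}_{\xi\sim N(\mu,\Sigma)}[F(x,\xi)]\}$, where $N(\mu,\Sigma)$ is the Gaussian distribution on $\mathbb{R}^d$ with mean $\mu$ and covariance $\Sigma$. The matrix $\Sigma$ is fixed and the states of nature are parametrized by $\mu\in\mathbb{R}^d$. The loss of an action $x\in X$ in state $\mu$ is $\mathcal{L}(\mu,x) := f_\mu(x) - \min_{z\in X} f_\mu(z)$, which for $F(x,\xi)=\xi^Tx$ is the expression in the claim. A decision rule is a (measurable) map $\delta : (\mathbb{R}^d)^n \to X$. $\Delta^n$ denotes the set of all decision rules $\delta:(\mathbb{R}^d)^n\to X$ such that the expectation $\mathbb{E}_{\xi^1,\ldots,\xi^n}[\delta(\xi^1,\ldots,\xi^n)]$ exists, where $\xi^1,\dots,\xi^n$ are i.i.d. $N(\mu,\Sigma)$. The risk of $\delta$ is $\mathcal{R}(\mu,\delta) := \mathbb{E}_{\xi^1,\ldots,\xi^n\ \text{i.i.d.}\ \sim N(\mu,\Sigma)}[\mathcal{L}(\mu,\delta(\xi^1,\ldots,\xi^n))]$. A decision rule $\delta'$ dominates $\delta$ if $\mathcal{R}(\mu,\delta')\le\mathcal{R}(\mu,\delta)$ for all $\mu\in\mathbb{R}^d$ and $\mathcal{R}(\hat\mu,\delta')<\mathcal{R}(\hat\mu,\delta)$ for some $\hat\mu\in\mathbb{R}^d$. A rule $\delta$ is admissible within $\Delta^n$ if no $\delta'\in\Delta^n$ dominates $\delta$. *)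

(* Defs.v *)
From HB Require Import structures.
From mathcomp Require Import all_boot all_order all_algebra.
From mathcomp Require Import all_classical all_reals all_analysis.
From mathcomp Require Import measurable_realfun.
From mathcomp Require Import ring lra.

Set Implicit Arguments.
Unset Strict Implicit.
Unset Printing Implicit Defensive.

Import Order.TTheory GRing.Theory Num.Theory.
Import numFieldNormedType.Exports.

Local Open Scope classical_set_scope.
Local Open Scope ring_scope.

Definition measure_matrix_display : measure_display -> measure_display.
Proof. exact. Qed.

Section measurable_matrix.
Context {d} {T : measurableType d} (m n : nat).

Definition matrix_cylinder : set (set 'M[T]_(m, n)) :=
  [set A | exists i j, exists2 B : set T,
     measurable B & A = (fun M : 'M[T]_(m, n) => M i j) @^-1` B].

Let matrix_measurable := <<s matrix_cylinder >>.

Let matrix_measurable0 : matrix_measurable set0.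
Proof. exact: sigma_algebra0. Qed.

Let matrix_measurableC A : matrix_measurable A -> matrix_measurable (~` A).
Proof. exact: sigma_algebraC. Qed.

Let matrix_measurable_bigcup (F : (set 'M[T]_(m, n))^nat) :
  (forall i, matrix_measurable (F i)) -> matrix_measurable (\bigcup_i F i).
Proof. exact: sigma_algebra_bigcup. Qed.

(* The product sigma-algebra; for T := R this is the Borel sigma-algebra. *)
HB.instance Definition _ := @isMeasurable.Build (measure_matrix_display d)
  'M[T]_(m, n) matrix_measurable
  matrix_measurable0 matrix_measurableC matrix_measurable_bigcup.

Lemma measurable_mxE (i : 'I_m) (j : 'I_n) :
  measurable_fun setT (fun M : 'M[T]_(m, n) => M i j).
Proof.
move=> _ B mB; rewrite setTI; apply: sub_sigma_algebra.
by exists i, j, B.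
Qed.

Lemma measurable_fun_mxP d' (T' : measurableType d') (f : T' -> 'M[T]_(m, n)) :
  (forall i j, measurable_fun setT (fun x => f x i j)) -> measurable_fun setT f.
Proof.
move=> mf; apply: (measurability matrix_cylinder) => // _ [_ [i [j [B mB ->]]] <-].
by rewrite setTI -(setTI (_ @^-1` _)); exact: mf.
Qed.

End measurable_matrix.

Lemma product_sigma_finite d1 d2 (T1 : measurableType d1)
    (T2 : measurableType d2) (R : realType)
    (m1 : {sigma_finite_measure set T1 -> \bar R})
    (m2 : {sigma_finite_measure set T2 -> \bar R}) :
  sigma_finite setT (m1 \x m2)%E.
Proof.
have /sigma_finiteP[F [TF ndF Foo]] := sigma_finiteT m1.
have /sigma_finiteP[G [TG ndG Goo]] := sigma_finiteT m2.
exists (fun n => F n `*` G n) => [|k].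
  rewrite -setXTT TF TG predeqE => -[x y]; split; last first.
    by move=> [n _ []/= ? ?]; split; exists n.
  move=> [/= [n _ Fnx] [k _ Gky]]; exists (maxn n k) => //; split.
  - by move: x Fnx; exact/subsetPset/ndF/leq_maxl.
  - by move: y Gky; exact/subsetPset/ndG/leq_maxr.
have [? ?] := Foo k; have [? ?] := Goo k; split; first exact: measurableX.
by rewrite product_measure1E// lte_mul_pinfty// ge0_fin_numE.
Qed.

Section prod_power.
Context {d} {T : measurableType d} {R : realType}.
Local Open Scope ereal_scope.

(* The n-fold product of mu, as a measure on n-tuples. *)
Fixpoint prod_power (mu : set T -> \bar R) (n : nat) : set (n.-tuple T) -> \bar R :=
  match n with
  | 0%N => \d_[tuple]
  | k.+1 => pushforward (mu \x @prod_power mu k)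
              (fun p : T * k.-tuple T => [tuple of p.1 :: p.2])
  end.

End prod_power.
Arguments prod_power {d T R} mu n _.

Section prod_power_measure.
Context {d} {T : measurableType d} {R : realType}.
Local Open Scope ereal_scope.

Lemma measurable_tuple_cons k :
  measurable_fun setT (fun p : T * k.-tuple T => [tuple of p.1 :: p.2]).
Proof. exact: measurable_cons. Qed.

Let prod_power_spec (mu : {sigma_finite_measure set T -> \bar R}) n :
  let nu := prod_power mu n in
  [/\ nu set0 = 0, forall A, 0 <= nu A, semi_sigma_additive nu
    & sigma_finite setT nu].
Proof.
elim: n => [|n]; cbv zeta.
  split; [exact: measure0|exact: measure_ge0| |exact: sigma_finiteT].
  exact: measure_semi_sigma_additive.
set nu := prod_power mu n => -[nu0 nu_ge0 nu_sigma nu_fin].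
pose nuM := HB.pack_for {measure set (n.-tuple T) -> \bar R} nu
  (isMeasure.Build _ _ _ nu nu0 nu_ge0 nu_sigma).
pose nuS := HB.pack_for {sigma_finite_measure set (n.-tuple T) -> \bar R} nu
  nuM (Measure_isSigmaFinite.Build _ _ _ nuM nu_fin).
pose f := fun p : T * n.-tuple T => [tuple of p.1 :: p.2].
pose g := fun t : n.+1.-tuple T => (thead t, [tuple of behead t]).
have fK : cancel f g.
  by move=> [x t]; rewrite /f /g /=; congr pair; apply: val_inj.
have gK : cancel g f.
  by move=> t; rewrite /f /g /= [RHS]tuple_eta; apply: val_inj.
have mf : measurable_fun setT f by exact: measurable_tuple_cons.
have mg : measurable_fun setT g.
  apply/measurable_fun_pairP; split; first exact: measurable_tnth.
  exact: measurable_behead.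
pose pM := measure_function_pushforward__canonical__measure_function_Measure
  (mu \x nuS) mf.
split; [exact: (measure0 pM)|exact: (measure_ge0 pM)| |].
  exact: (@measure_semi_sigma_additive _ _ _ pM).
have [F FT Foo] := product_sigma_finite mu nuS.
exists (fun i => g @^-1` (F i)) => [|i].
  by rewrite -preimage_bigcup -FT preimage_setT.
have [mFi Fioo] := Foo i; split.
  by rewrite -(setTI (_ @^-1` _)); exact: mg.
rewrite /= /pushforward -comp_preimage (_ : g \o f = id) //.
by apply/funext => x /=; rewrite fK.
Qed.

Section sigma_finite.
Variables (mu : {sigma_finite_measure set T -> \bar R}) (n : nat).

Let prod_power0 : prod_power mu n set0 = 0.
Proof. by case: (prod_power_spec mu n). Qed.

Let prod_power_ge0 A : 0 <= prod_power mu n A.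
Proof. by case: (prod_power_spec mu n). Qed.

Let prod_power_sigma_additive : semi_sigma_additive (prod_power mu n).
Proof. by case: (prod_power_spec mu n). Qed.

Let prod_power_sigma_finite : sigma_finite setT (prod_power mu n).
Proof. by case: (prod_power_spec mu n). Qed.

HB.instance Definition _ := isMeasure.Build _ _ _ (prod_power mu n)
  prod_power0 prod_power_ge0 prod_power_sigma_additive.

HB.instance Definition _ := Measure_isSigmaFinite.Build _ _ _ (prod_power mu n)
  prod_power_sigma_finite.

End sigma_finite.

Section probability.
Variables (P : probability T R) (n : nat).

Let prod_power_setT : prod_power P n setT = 1.
Proof.
elim: n => [|k IHk]; first exact: diracT.
rewrite /= /pushforward preimage_setT -setXTT product_measure1E//.
transitivity (P setT * prod_power P k setT) => //.
by rewrite IHk mule1; exact: probability_setT.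
Qed.

HB.instance Definition _ := Measure.on (prod_power P n).
HB.instance Definition _ := Measure_isProbability.Build _ _ _ (prod_power P n)
  prod_power_setT.

End probability.

End prod_power_measure.

Section gaussian.
Context {R : realType}.
Local Notation mu := (@lebesgue_measure R).

Definition col_of_tuple d (t : d.-tuple (measurableTypeR R)) : 'cV[R]_d :=
  \col_i tnth t i.

Lemma measurable_col_of_tuple d : measurable_fun setT (@col_of_tuple d).
Proof.
apply: measurable_fun_mxP => i j; under eq_fun do rewrite mxE.
exact: (@measurable_tnth _ (measurableTypeR R)).
Qed.

(* Lebesgue measure on R^d. *)
Definition lebesgue_cV d : set 'cV[R]_d -> \bar R :=
  pushforward (prod_power mu d) (@col_of_tuple d).

HB.instance Definition _ d := isMeasure.Build _ _ _ (@lebesgue_cV d)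
  (measure0 (measure_function_pushforward__canonical__measure_function_Measure
     (prod_power mu d) (@measurable_col_of_tuple d)))
  (measure_ge0 (measure_function_pushforward__canonical__measure_function_Measure
     (prod_power mu d) (@measurable_col_of_tuple d)))
  (@measure_semi_sigma_additive _ _ _
    (measure_function_pushforward__canonical__measure_function_Measure
     (prod_power mu d) (@measurable_col_of_tuple d))).

Let lebesgue_cV_sigma_finite d : sigma_finite setT (@lebesgue_cV d).
Proof.
have [F FT Foo] := sigma_finiteT
  (prod_power mu d : {sigma_finite_measure set _ -> \bar R}).
pose g (v : 'cV[R]_d) : d.-tuple (measurableTypeR R) := [tuple v i 0 | i < d].
have mg : measurable_fun setT g.
  apply/measurable_fun_tnthP => i.
  rewrite (_ : _ \o _ = fun v : 'cV[R]_d => v i 0); first exact: measurable_mxE.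
  by apply/funext => v /=; rewrite tnth_mktuple.
exists (fun i => g @^-1` (F i)) => [|i].
  by rewrite -preimage_bigcup -FT preimage_setT.
have [mFi Fioo] := Foo i; split.
  by rewrite -(setTI (_ @^-1` _)); exact: mg.
rewrite /lebesgue_cV /pushforward -comp_preimage (_ : g \o _ = id) //.
apply/funext => t /=; apply: eq_from_tnth => j.
by rewrite tnth_mktuple mxE.
Qed.

HB.instance Definition _ d := Measure_isSigmaFinite.Build _ _ _ (@lebesgue_cV d)
  (@lebesgue_cV_sigma_finite d).

Definition qform d (A : 'M[R]_d) (v : 'cV[R]_d) : R := (v^T *m A *m v) 0 0.

Definition posdefmx d (A : 'M[R]_d) : Prop :=
  A^T = A /\ forall v : 'cV[R]_d, v != 0 -> 0 < qform A v.

Lemma measurable_qform d (A : 'M[R]_d) : measurable_fun setT (qform A).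
Proof.
rewrite /qform.
under eq_fun => v.
  rewrite mxE; under eq_bigr do rewrite mxE.
  over.
apply: measurable_sum => i; apply: measurable_funM; last exact: measurable_mxE.
apply: measurable_sum => j; apply: measurable_funM => //.
under eq_fun do rewrite mxE; exact: measurable_mxE.
Qed.

Definition gaussian_pdf d (m : 'cV[R]_d) (S : 'M[R]_d) (x : 'cV[R]_d) : R :=
  (Num.sqrt ((2 * pi) ^+ d * \det S))^-1 *
  expR (- qform (invmx S) (x - m) / 2).

Lemma measurable_gauss_exp d (A : 'M[R]_d) (m : 'cV[R]_d) :
  measurable_fun setT (fun x : 'cV[R]_d => expR (- qform A (x - m) / 2)).
Proof.
apply: measurableT_comp => //=; apply: measurable_funM => //.
apply: measurableT_comp => //=.
apply: (@measurableT_comp _ _ _ _ _ _ (@qform d A) _ (fun x : 'cV[R]_d => x - m)).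
  exact: measurable_qform.
apply: measurable_fun_mxP => i j.
under eq_fun do rewrite !mxE.
by apply: measurable_funB => //; exact: measurable_mxE.
Qed.

Lemma measurable_gaussian_pdf d (m : 'cV[R]_d) (S : 'M[R]_d) :
  measurable_fun setT (gaussian_pdf m S).
Proof. by apply: measurable_funM => //; exact: measurable_gauss_exp. Qed.

Lemma gaussian_pdf_ge0 d (m : 'cV[R]_d) (S : 'M[R]_d) x :
  0 <= gaussian_pdf m S x.
Proof. by rewrite mulr_ge0 ?expR_ge0// invr_ge0 sqrtr_ge0. Qed.

Lemma integral_expR_sqr (a m : R) : 0 < a ->
  (\int[mu]_x (expR (- (a * (x - m) ^+ 2) / 2))%:E)%E
  = (Num.sqrt (2 * pi / a))%:E.
Proof.
move=> a0; pose s := Num.sqrt a^-1.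
have s0 : s != 0 by rewrite gt_eqF// sqrtr_gt0 invr_gt0.
have s2 : s ^+ 2 = a^-1 by rewrite sqr_sqrtr// invr_ge0 ltW.
have := integral_normal_pdf m s.
under eq_integral do rewrite normal_pdfE// EFinM.
rewrite ge0_integralZl//; last 3 first.
- by apply/measurable_EFinP; exact: measurable_normal_fun.
- by move=> x _; rewrite lee_fin normal_fun_ge0.
- by rewrite lee_fin normal_peak_ge0.
have -> : (\int[mu]_x (normal_fun m s x)%:E =
    \int[mu]_x (expR (- (a * (x - m) ^+ 2) / 2))%:E)%E.
  apply: eq_integral => x _; congr (expR _)%:E; rewrite s2.
  by field; rewrite gt_eqF.
set I := (\int[mu]_x _)%E => HI.
have p0 := normal_peak_gt0 s0.
have : ((normal_peak s)^-1%:E * ((normal_peak s)%:E * I) = (normal_peak s)^-1%:E)%E.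
  by rewrite HI mule1.
rewrite muleA -EFinM mulVf ?gt_eqF// mul1e => ->.
congr EFin; rewrite /normal_peak invrK s2; congr Num.sqrt.
by rewrite -mulr_natl; ring.
Qed.

Lemma schur_complement d (A : 'M[R]_(1 + d)) : posdefmx A ->
  let a := A 0 0 in
  let b := ursubmx A in
  let S := drsubmx A - a^-1 *: (b^T *m b) in
  [/\ 0 < a, posdefmx S, \det A = a * \det S &
    forall (x : R) (u : 'cV[R]_d), qform A (col_mx x%:M u) =
      a * (x + (b *m u) 0 0 / a) ^+ 2 + qform S u].
Proof.
move=> [Asym Apos] a b S.
have AE : A = block_mx a%:M b b^T (drsubmx A).
  rewrite -[LHS]submxK; congr block_mx; last by rewrite trmx_ursub Asym.
  by rewrite [LHS]mx11_scalar !mxE; congr (A _ _)%:M; apply: val_inj.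
set D := drsubmx A in S AE *.
have Dsym : D^T = D by rewrite /D trmx_drsub Asym.
have qE (x : R) (u : 'cV[R]_d) : qform A (col_mx x%:M u) =
    a * x ^+ 2 + 2 * x * (b *m u) 0 0 + qform D u.
  rewrite /qform AE tr_col_mx tr_scalar_mx mul_row_block mul_row_col.
  rewrite !mulmxDl -scalar_mxM !mul_mx_scalar !mul_scalar_mx -trmx_mul.
  rewrite scale_scalar_mx -scalemxAl !mxE /= mulr1n.
  by set t := \sum_(_ < _) _; set w := \sum_(_ < _) _; ring.
have a0 : 0 < a.
  have : 0 < qform A (col_mx 1%:M 0).
    apply: Apos; apply/negP => /eqP/(congr1 usubmx).
    rewrite col_mxKu linear0 => /matrixP/(_ 0 0)/eqP.
    by rewrite !mxE /= oner_eq0.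
  by rewrite qE mulmx0 /qform mulmx0 !mxE mulr0 !addr0 expr1n mulr1.
have aN0 : a != 0 by rewrite gt_eqF.
have SE u : qform S u = qform D u - (b *m u) 0 0 ^+ 2 / a.
  rewrite /qform /S mulmxBr mulmxBl mxE -scalemxAr -scalemxAl; congr (_ + _).
  rewrite mxE [in LHS]mxE mulmxA -trmx_mul -mulmxA mxE big_ord1 mxE expr2.
  by rewrite mulrC.
have qS (x : R) (u : 'cV[R]_d) : qform A (col_mx x%:M u) =
    a * (x + (b *m u) 0 0 / a) ^+ 2 + qform S u.
  by rewrite qE SE; field.
split => //.
- split=> [|u u0].
    by rewrite /S linearB linearZ /= trmx_mul trmxK Dsym.
  have := Apos (col_mx (- ((b *m u) 0 0 / a))%:M u).
  rewrite qS addNr expr0n mulr0 add0r; apply.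
  by apply: contra_neq u0 => /(congr1 dsubmx); rewrite col_mxKd linear0.
- rewrite {1}AE (_ : block_mx _ _ _ _ =
    block_mx 1%:M 0 (a^-1 *: b^T) 1%:M *m block_mx a%:M b 0 S).
    by rewrite det_mulmx det_lblock det_ublock !det1 !mul1r det_scalar expr1.
  rewrite mulmx_block !mul1mx !mul0mx !addr0.
  congr block_mx.
    by rewrite -scalemxAl mul_mx_scalar scalerA mulVf// scale1r.
  by rewrite /S -scalemxAl addrC subrK.
Qed.

Lemma gauss_mass d (A : 'M[R]_d) (m : 'cV[R]_d) : posdefmx A ->
  0 < \det A /\
  (\int[@lebesgue_cV d]_x (expR (- qform A (x - m) / 2))%:E)%E =
  (Num.sqrt ((2 * pi) ^+ d / \det A))%:E.
Proof.
have iE k (B : 'M[R]_k) (p : 'cV[R]_k) :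
    (\int[@lebesgue_cV k]_x (expR (- qform B (x - p) / 2))%:E =
     \int[prod_power mu k]_t (expR (- qform B (col_of_tuple t - p) / 2))%:E)%E.
  rewrite (ge0_integral_pushforward (@measurable_col_of_tuple k))//.
    by apply/measurable_EFinP; exact: measurable_gauss_exp.
move=> Apd; rewrite iE; elim: d A m Apd => [A m _|d IHd A m Apd].
  rewrite det_mx00 ltr01 expr0 divr1 sqrtr1; split=> //.
  rewrite (eq_integral (cst 1%E)) => [|t _].
    by rewrite integral_cst// mul1e; exact: diracT.
  by rewrite /qform [(_ - _)^T]thinmx0 !mul0mx mxE oppr0 mul0r expR0.
have [a0 Spd detA qA] := schur_complement Apd.
set a := A 0 0 in a0 detA qA; set b := @ursubmx _ 1 d 1 d A in qA.
set S := (@drsubmx _ 1 d 1 d A - _) in Spd detA qA.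
have [detS IH] := IHd S (dsubmx (m : 'cV[R]_(1 + d))) Spd.
split; first by rewrite detA mulr_gt0.
have mf k (B : 'M[R]_k) (p : 'cV[R]_k) : measurable_fun setT
    (fun t => (expR (- qform B (col_of_tuple t - p) / 2))%:E).
  apply/measurable_EFinP.
  exact: measurableT_comp (measurable_gauss_exp B p) (@measurable_col_of_tuple k).
rewrite [LHS](ge0_integral_pushforward
  (@measurable_tuple_cons _ (measurableTypeR R) d) (mu \x prod_power mu d)%E)//;
  last exact: mf.
rewrite preimage_setT fubini_tonelli2//; last 2 first.
- exact: measurableT_comp (mf _ A m) (@measurable_tuple_cons _ _ d).
- by move=> ?; rewrite lee_fin expR_ge0.
rewrite /fubini_G /=.
rewrite (eq_integral (fun t => ((Num.sqrt (2 * pi / a))%:E *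
     (expR (- qform S (col_of_tuple t - dsubmx (m : 'cV[R]_(1 + d))) / 2))%:E)%E));
  last first.
  move=> t _; set u := col_of_tuple t - _; pose B := (b *m u) 0 0.
  transitivity (\int[mu]_x ((expR (- (a * (x - (m 0 0 - B / a)) ^+ 2) / 2))%:E *
      (expR (- qform S u / 2))%:E))%E.
    apply: eq_integral => x _; rewrite -EFinM -expRD -mulrDl -opprD.
    rewrite (_ : col_of_tuple _ - m = col_mx (x - m 0 0)%:M u).
      by rewrite qA -/B opprB addrA addrAC.
    rewrite -[LHS](@vsubmxK _ 1 d); congr (@col_mx _ 1 d 1 _ _); apply/matrixP => i j.
      by rewrite (ord1 i) (ord1 j) !mxE lshift0 mulr1n.
    rewrite !mxE (ord1 j) (_ : rshift 1 i = lift ord0 i) ?tnthS//.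
    exact: val_inj.
  rewrite ge0_integralZr//; last first.
    apply/measurable_EFinP; apply: measurableT_comp => //.
    apply: measurable_funM => //; apply: measurableT_comp => //.
    apply: measurable_funM => //; apply: measurable_funX.
    exact: measurable_funB.
  by rewrite integral_expR_sqr.
rewrite ge0_integralZl//; last by exact: mf.
rewrite IH -EFinM -sqrtrM; last by rewrite divr_ge0 ?mulr_ge0 ?pi_ge0// ltW.
by congr (Num.sqrt _)%:E; rewrite detA exprS; field; rewrite !gt_eqF.
Qed.

Lemma posdefmx_unit d (S : 'M[R]_d) : posdefmx S -> S \in unitmx.
Proof. by move=> /(gauss_mass 0)[S0 _]; rewrite unitmxE unitfE gt_eqF. Qed.

Lemma posdefmx_inv d (S : 'M[R]_d) : posdefmx S -> posdefmx (invmx S).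
Proof.
move=> Spd; have [Ssym Spos] := Spd; have Su := posdefmx_unit Spd.
split=> [|v v0]; first by rewrite trmx_inv Ssym.
have -> : qform (invmx S) v = qform S (invmx S *m v).
  by rewrite /qform trmx_mul trmx_inv Ssym -!mulmxA mulKVmx.
by apply: Spos; apply: contra_neq v0 => /(congr1 (mulmx S)); rewrite mulKVmx// mulmx0.
Qed.

Lemma integral_gaussian_pdf d (m : 'cV[R]_d) (S : 'M[R]_d) : posdefmx S ->
  (\int[@lebesgue_cV d]_x (gaussian_pdf m S x)%:E = 1)%E.
Proof.
move=> Spd; have [S0 _] := gauss_mass 0 Spd.
under eq_integral do rewrite /gaussian_pdf EFinM.
rewrite ge0_integralZl//; last first.
  by apply/measurable_EFinP; exact: measurable_gauss_exp.
have [_ ->] := gauss_mass m (posdefmx_inv Spd).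
rewrite det_inv invrK -EFinM mulVf// gt_eqF// sqrtr_gt0.
by rewrite mulr_gt0// exprn_gt0// mulr_gt0// pi_gt0.
Qed.

(* N(m, S); the Dirac branch is a junk value. *)
Definition gaussian_law d (m : 'cV[R]_d) (S : 'M[R]_d) : set 'cV[R]_d -> \bar R :=
  if `[< posdefmx S >]
  then fun A => (\int[@lebesgue_cV d]_(x in A) (gaussian_pdf m S x)%:E)%E
  else \d_m.

Section gaussian_law_probability.
Variables (d : nat) (m : 'cV[R]_d) (S : 'M[R]_d).

Let gaussian_law0 : gaussian_law m S set0 = 0%E.
Proof.
by rewrite /gaussian_law; case: asboolP => _; rewrite ?integral_set0 ?measure0.
Qed.

Let gaussian_law_ge0 A : (0 <= gaussian_law m S A)%E.
Proof.
rewrite /gaussian_law; case: asboolP => _; last exact: measure_ge0.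
by apply: integral_ge0 => x _; rewrite lee_fin gaussian_pdf_ge0.
Qed.

Let gaussian_law_sigma_additive : semi_sigma_additive (gaussian_law m S).
Proof.
rewrite /gaussian_law; case: asboolP => _.
  apply: semi_sigma_additive_nng_induced => [|x].
    by apply/measurable_EFinP; exact: measurable_gaussian_pdf.
  by rewrite lee_fin gaussian_pdf_ge0.
exact: measure_semi_sigma_additive.
Qed.

HB.instance Definition _ := isMeasure.Build _ _ _ (gaussian_law m S)
  gaussian_law0 gaussian_law_ge0 gaussian_law_sigma_additive.

Let gaussian_law_setT : gaussian_law m S setT = 1%E.
Proof.
rewrite /gaussian_law; case: asboolP => [|_]; last exact: diracT.
exact: integral_gaussian_pdf.
Qed.

HB.instance Definition _ := Measure_isProbability.Build _ _ _
  (gaussian_law m S) gaussian_law_setT.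

End gaussian_law_probability.

End gaussian.

Section decision.
Context {R : realType} {d n : nat}.
Implicit Types (X : set 'cV[R]_d) (S : 'M[R]_d) (m x : 'cV[R]_d).
Implicit Types (delta : n.-tuple 'cV[R]_d -> 'cV[R]_d).

Definition dotmx (u v : 'cV[R]_d) : R := (u^T *m v) 0 0.

(* The joint law of n i.i.d. samples of N(m, S). *)
Definition sample_law m S : probability (n.-tuple 'cV[R]_d) R :=
  prod_power (gaussian_law m S) n.

Definition sample_mean (xi : n.-tuple 'cV[R]_d) : 'cV[R]_d :=
  n%:R^-1 *: \sum_(i < n) tnth xi i.

(* For nonempty compact X the infimum is attained, i.e. it is a minimum. *)
Definition loss X m x : R := dotmx m x - inf [set dotmx m z | z in X].

Definition decision_rule X delta : Prop :=
  measurable_fun setT delta /\ forall xi, X (delta xi).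

(* The class Delta^n: the vector mean E[delta] exists in every state m. *)
Definition rules_with_mean X S delta : Prop :=
  decision_rule X delta /\
  forall m (i : 'I_d),
    (sample_law m S).-integrable setT (fun xi => (delta xi i 0)%:E).

Definition risk X S m delta : \bar R :=
  'E_(sample_law m S)[fun xi => loss X m (delta xi)]%E.

Definition dominates X S delta' delta : Prop :=
  (forall m, risk X S m delta' <= risk X S m delta)%E /\
  exists m, (risk X S m delta' < risk X S m delta)%E.

Definition admissible X S delta : Prop :=
  ~ exists delta', rules_with_mean X S delta' /\ dominates X S delta' delta.

Definition sample_average_rule X delta : Prop :=
  decision_rule X delta /\
  forall xi, X (delta xi) /\
    forall x, X x -> dotmx (sample_mean xi) (delta xi) <= dotmx (sample_mean xi) x.

End decision.

(* Main.v *)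
Require Import Defs.
From HB Require Import structures.
From mathcomp Require Import all_boot all_order all_algebra.
From mathcomp Require Import all_classical all_reals all_analysis.
From mathcomp Require Import measurable_realfun.
From mathcomp Require Import ring lra.

Set Implicit Arguments.
Unset Strict Implicit.
Unset Printing Implicit Defensive.

Import Order.TTheory GRing.Theory Num.Theory.
Import numFieldNormedType.Exports.

Local Open Scope classical_set_scope.
Local Open Scope ring_scope.

(** The sample average rule is a Bayes rule for a prior that charges every open
    set of states, and the risk is a continuous function of the state; such a
    rule is admissible.

    Take the prior N(0, Sigma / n) on the state mu. By conjugacy, the posterior
    given the sample is Gaussian with mean equal to half the sample mean
    ([posterior_kernel]). The loss is linear in mu up to a term that does not
    involve the action, so its posterior expectation is minimized by the
    actions that minimize the inner product with the sample mean. Hence no rule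
    has a smaller Bayes risk than the sample average rule
    ([bayes_risk_sample_average]).

    A rule delta' that dominates the sample average rule delta has a risk at
    most that of delta in every state, and a Bayes risk at least that of delta.
    The Bayes risks are finite, so the two risks agree for almost every mu
    ([shifted_risk_ae_eq]). Every state is a limit of states at which they
    agree ([ae_lebesgue_cV_dense]), and the risks are continuous in mu by
    dominated convergence ([cvg_shifted_risk]), so they agree everywhere. This
    contradicts the strict inequality in some state.

    The argument needs the mean of a Gaussian kernel ([gauss_mean]). It is
    obtained from the total mass of the kernels alone: the exponential moments
    are masses of translated kernels, and exp is above its tangent at 0. *)

Local Notation dotmx := Defs.dotmx.

(** * Densities and product measures *)

(** The difference g - f is nonnegative and its integral vanishes. *)
Lemma ae_eq_of_le_integral {d} {T : measurableType d} {R : realType}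
    (mu : {measure set T -> \bar R}) (f g : T -> \bar R) :
  measurable_fun setT f -> measurable_fun setT g ->
  (forall x, 0 <= f x)%E -> (forall x, f x <= g x)%E ->
  (forall x, g x \is a fin_num) ->
  (\int[mu]_x g x <= \int[mu]_x f x)%E -> (\int[mu]_x f x < +oo)%E ->
  {ae mu, forall x, f x = g x}.
Proof.
move=> mf mg f0 fg gfin gf foo.
have g0 x : (0 <= g x)%E by exact: le_trans (fg x).
have ffin x : f x \is a fin_num.
  by rewrite ge0_fin_numE// (le_lt_trans (fg x))// -ge0_fin_numE.
have fi : mu.-integrable setT f.
  apply/integrableP; split => //.
  by under eq_integral do rewrite gee0_abs//.
have gi : mu.-integrable setT g.
  apply/integrableP; split => //.
  under eq_integral do rewrite gee0_abs//.
  exact: le_lt_trans gf foo.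
have gfE : (\int[mu]_x g x = \int[mu]_x f x)%E.
  by apply/eqP; rewrite eq_le gf/=; apply: ge0_le_integral.
have /(ae_eq_integral_abs mu measurableT _).1 : (\int[mu]_x `|(g \- f) x| = 0)%E.
  rewrite (eq_integral (g \- f)%E); last first.
    by move=> x _; rewrite /= gee0_abs// suber_ge0.
  by rewrite integralB// gfE subee// (integrable_fin_num _ fi).
move=> /(_ (emeasurable_funB mg mf)).
apply: filterS => x /(_ I) /= /eqP.
by rewrite sube_eq ?fin_num_adde_defl// add0e => /eqP.
Qed.

Section density.
Context {d} {T : measurableType d} {R : realType}.
Local Open Scope ereal_scope.
Import HBNNSimple.

(** Both sides are additive and commute with monotone limits, so the identity
    extends from indicators to all nonnegative measurable functions. *)
Lemma ge0_integral_density (lam nu : {measure set T -> \bar R}) (p : T -> R)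
    (f : T -> \bar R) :
  measurable_fun setT p -> (forall x, 0 <= p x)%R ->
  (forall A, measurable A -> nu A = \int[lam]_(x in A) (p x)%:E) ->
  measurable_fun setT f -> (forall x, 0 <= f x) ->
  \int[nu]_x f x = \int[lam]_x (f x * (p x)%:E).
Proof.
move=> mp p0 nuE mf f0; pose h := nnsfun_approx measurableT mf.
have hE x : f x = limn (fun k => (h k x)%:E).
  by apply/esym/cvg_lim => //; exact: cvg_nnsfun_approx.
have hnd x : {homo (fun k => h k x) : a b / (a <= b)%N >-> (a <= b)%R}.
  by move=> a b ab; exact/lefP/nd_nnsfun_approx.
have hN k : \int[nu]_x (h k x)%:E = \int[lam]_x ((h k x)%:E * (p x)%:E).
  have -> : \int[nu]_x (h k x)%:E =
      \sum_(y \in range (h k)) (y%:E * nu (h k @^-1` [set y])).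
    by rewrite -sintegralE; exact: integralT_nnsfun.
  transitivity (\sum_(y \in range (h k))
      \int[lam]_x ((y * \1_(h k @^-1` [set y]) x * p x)%:E)); last first.
    rewrite -ge0_integral_fsum//.
    - apply: eq_integral => x _.
      rewrite [in RHS]fimfunE -EFinM fsumEFin//; congr EFin.
      by rewrite mulrC mulr_fsumr; apply: eq_fsbigr => y _; rewrite mulrC.
    - move=> y; apply/measurable_EFinP; apply: measurable_funM => //.
      exact: measurable_funM.
    - by move=> y x _; rewrite 2!EFinM mule_ge0 ?nnfun_muleindic_ge0 ?lee_fin.
  apply: eq_fsbigr => y /set_mem[x _ <-].
  rewrite nuE// [RHS](eq_integral (fun z => (h k x)%:E *
     (\1_(h k @^-1` [set h k x]) z * p z)%:E)); last first.
    by move=> z _; rewrite -EFinM mulrA.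
  rewrite ge0_integralZl//; last 3 first.
  - by apply/measurable_EFinP; exact: measurable_funM.
  - by move=> z _; rewrite lee_fin mulr_ge0.
  - by rewrite lee_fin.
  rewrite integral_mkcond; congr (_ * _); apply: eq_integral => z _.
  rewrite patchE indicE; by case: ifP => _; rewrite ?mul1r ?mul0r.
under eq_integral do rewrite hE.
rewrite monotone_convergence//; last 3 first.
- by move=> k; exact/measurable_EFinP.
- by move=> k x _; rewrite lee_fin.
- by move=> x _ a b ab; rewrite lee_fin hnd.
under eq_fun do rewrite hN.
rewrite -monotone_convergence//.
- apply: eq_integral => x _; apply/cvg_lim => //; apply: cvgeZr => //.
  exact: cvg_nnsfun_approx.
- by move=> k; apply: emeasurable_funM; exact/measurable_EFinP.
- by move=> k x _; rewrite mule_ge0// lee_fin.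
- by move=> x _ a b ab; rewrite lee_wpmul2r ?lee_fin// hnd.
Qed.

Lemma ge0_integral_prod_powerS (mu : {sigma_finite_measure set T -> \bar R}) n
    (f : n.+1.-tuple T -> \bar R) :
  measurable_fun setT f -> (forall t, 0 <= f t) ->
  \int[prod_power mu n.+1]_t f t =
  \int[mu]_x \int[prod_power mu n]_t f [tuple of x :: t].
Proof.
move=> mf f0.
rewrite [LHS](ge0_integral_pushforward
  (@measurable_tuple_cons _ T n) (mu \x prod_power mu n))// preimage_setT.
rewrite fubini_tonelli1//.
- exact: measurableT_comp mf (@measurable_tuple_cons _ T n).
- by move=> z; exact: f0.
Qed.

Lemma measurable_prod_tnth n (p : T -> R) : measurable_fun setT p ->
  measurable_fun setT (fun t : n.-tuple T => \prod_(i < n) p (tnth t i))%R.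
Proof.
move=> mp; apply: measurable_prod => i _.
exact: measurableT_comp mp (measurable_tnth i).
Qed.

(** Tonelli splits off one factor; the others come from the induction. *)
Lemma ge0_integral_prod_power_density
    (lam nu : {sigma_finite_measure set T -> \bar R}) (p : T -> R) n
    (f : n.-tuple T -> \bar R) :
  measurable_fun setT p -> (forall x, 0 <= p x)%R ->
  (forall A, measurable A -> nu A = \int[lam]_(x in A) (p x)%:E) ->
  measurable_fun setT f -> (forall t, 0 <= f t) ->
  \int[prod_power nu n]_t f t =
  \int[prod_power lam n]_t (f t * (\prod_(i < n) p (tnth t i))%:E).
Proof.
move=> mp p0 nuE; elim: n f => [|n IHn] f mf f0.
  by apply: eq_integral => t _; rewrite big_ord0 mule1.
have mcons x : measurable_fun setT (fun t : n.-tuple T => [tuple of x :: t]).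
  exact: measurableT_comp (@measurable_tuple_cons _ T n) (pair1_measurable x).
rewrite !ge0_integral_prod_powerS//; last 2 first.
- apply: emeasurable_funM => //; apply/measurable_EFinP.
  exact: measurable_prod_tnth.
- by move=> t; rewrite mule_ge0// lee_fin prodr_ge0.
under eq_integral.
  move=> x _; rewrite IHn//; last exact: measurableT_comp mf (mcons x).
  over.
have mg : measurable_fun setT (fun z : T * n.-tuple T =>
    f [tuple of z.1 :: z.2] * (\prod_(i < n) p (tnth z.2 i))%:E).
  apply: emeasurable_funM.
    exact: measurableT_comp mf (@measurable_tuple_cons _ T n).
  apply/measurable_EFinP.
  apply: measurable_prod => i _; apply: measurableT_comp => //.
  exact: measurableT_comp (measurable_tnth i) measurable_snd.
have g0 (z : T * n.-tuple T) :
    0 <= f [tuple of z.1 :: z.2] * (\prod_(i < n) p (tnth z.2 i))%:E.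
  by rewrite mule_ge0// lee_fin prodr_ge0.
rewrite (ge0_integral_density mp p0 nuE); last 2 first.
- exact: (@measurable_fun_fubini_tonelli_F _ _ _ _ _ (prod_power lam n) _ mg g0).
- by move=> x; apply: integral_ge0 => t _; exact: (g0 (x, t)).
apply: eq_integral => x _.
rewrite -ge0_integralZr//; last 3 first.
- exact: (measurableT_comp mg (pair1_measurable x)).
- by move=> t _; exact: (g0 (x, t)).
- by rewrite lee_fin.
apply: eq_integral => t _.
rewrite -muleA -EFinM big_ord_recl mulrC tnth0.
by under [in RHS]eq_bigr do rewrite tnthS.
Qed.

Lemma prod_power_box_gt0 (mu : {sigma_finite_measure set T -> \bar R}) n
    (B : 'I_n -> set T) :
  (forall i, measurable (B i)) -> (forall i, 0 < mu (B i)) ->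
  0 < prod_power mu n [set t | forall i, B i (tnth t i)].
Proof.
move=> mB B0; elim: n B mB B0 => [|n IHn] B mB B0 /=.
  by rewrite (_ : [set _ | _] = setT) ?diracT//; apply/seteqP; split => // t _ [].
rewrite /pushforward (_ : _ @^-1` _ =
    B ord0 `*` [set t | forall i, B (lift ord0 i) (tnth t i)]); last first.
  apply/seteqP; split => -[x t] /=.
    move=> H; split; first by have := H ord0; rewrite tnth0.
    by move=> i; have := H (lift ord0 i); rewrite tnthS.
  move=> [Bx Bt] i; case: (unliftP ord0 i) => [j|] ->; last by rewrite tnth0.
  by rewrite tnthS.
rewrite product_measure1E//.
  apply: mule_gt0; first exact: B0.
  by apply: (IHn (fun i => B (lift ord0 i))) => i; [exact: mB|exact: B0].
rewrite (_ : [set _ | _] =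
  \bigcap_(i in [set: 'I_n]) ((@tnth n T)^~ i @^-1` B (lift ord0 i))).
  apply: fin_bigcap_measurable => // i _.
  by rewrite -[X in measurable X]setTI; exact: measurable_tnth.
by apply/seteqP; split=> t /=; [move=> H i _|move=> H i]; exact: H.
Qed.

End density.

(** * Quadratic forms *)

Section bilinear.
Context {R : realType} {d : nat}.
Implicit Types (A : 'M[R]_d) (u v w : 'cV[R]_d).

Lemma cdotE u v : dotmx u v = \sum_i u i 0 * v i 0.
Proof. by rewrite /dotmx mxE; apply: eq_bigr => i _; rewrite mxE. Qed.

Lemma cdotC u v : dotmx u v = dotmx v u.
Proof. by rewrite !cdotE; apply: eq_bigr => i _; rewrite mulrC. Qed.

Lemma cdotDl u v w : dotmx (u + v) w = dotmx u w + dotmx v w.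
Proof. by rewrite /dotmx linearD mulmxDl mxE. Qed.

Lemma cdotZl (a : R) u v : dotmx (a *: u) v = a * dotmx u v.
Proof. by rewrite /dotmx linearZ /= -scalemxAl mxE. Qed.

Lemma cdotDr u v w : dotmx u (v + w) = dotmx u v + dotmx u w.
Proof. by rewrite /dotmx mulmxDr mxE. Qed.

Lemma cdotZr (a : R) u v : dotmx u (a *: v) = a * dotmx u v.
Proof. by rewrite /dotmx -scalemxAr mxE. Qed.

Lemma cdotNl u v : dotmx (- u) v = - dotmx u v.
Proof. by rewrite -scaleN1r cdotZl mulN1r. Qed.

Lemma cdot_mull A u v : A^T = A -> dotmx (A *m u) v = dotmx u (A *m v).
Proof. by move=> As; rewrite /dotmx trmx_mul As mulmxA. Qed.

Lemma qformE A u : qform A u = dotmx u (A *m u).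
Proof. by rewrite /qform /dotmx mulmxA. Qed.

Lemma qformD A u v : A^T = A ->
  qform A (u + v) = qform A u + qform A v + 2 * dotmx u (A *m v).
Proof.
move=> As; rewrite !qformE mulmxDr !cdotDl !cdotDr.
by rewrite (cdotC v (A *m u)) cdot_mull//; ring.
Qed.

Lemma qformZ A (a : R) u : qform A (a *: u) = a ^+ 2 * qform A u.
Proof. by rewrite !qformE -scalemxAr cdotZl cdotZr mulrA expr2. Qed.

Lemma qformZl A (a : R) u : qform (a *: A) u = a * qform A u.
Proof. by rewrite !qformE -scalemxAl cdotZr. Qed.

Lemma qformN A u : qform A (- u) = qform A u.
Proof. by rewrite -scaleN1r qformZ sqrrN expr1n mul1r. Qed.

Lemma qformB A u v : A^T = A ->
  qform A (u - v) = qform A u + qform A v - 2 * dotmx u (A *m v).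
Proof.
move=> As; rewrite qformD// qformN mulmxN (cdotC u (- _)) cdotNl.
by rewrite (cdotC _ u); ring.
Qed.

Lemma qform_ge0 A u : posdefmx A -> 0 <= qform A u.
Proof.
move=> [_ Apos]; have [->|u0] := eqVneq u 0; last exact/ltW/Apos.
by rewrite /qform mulmx0 mxE.
Qed.

Lemma posdefmxZ A (a : R) : 0 < a -> posdefmx A -> posdefmx (a *: A).
Proof.
move=> a0 [As Apos]; split; first by rewrite linearZ /= As.
by move=> v v0; rewrite qformZl mulr_gt0// Apos.
Qed.

Lemma measurable_dotmxl v : measurable_fun setT (fun x : 'cV[R]_d => dotmx x v).
Proof.
under eq_fun do rewrite cdotE.
by apply: measurable_sum => i; apply: measurable_funM => //; exact: measurable_mxE.
Qed.

End bilinear.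

(** * The mean of a Gaussian kernel *)

Section gauss_mean.
Context {R : realType} {d : nat}.
Implicit Types (A : 'M[R]_d) (m v : 'cV[R]_d).

(** The right-hand side is Z + O(t^2), so the line on the left can stay below
    it on both sides of t = 0 only if its slope vanishes. *)
Lemma eq0_of_exp_tangent (c Z k : R) : 0 <= Z -> 0 <= k ->
  (forall t, t * c + Z <= expR (t ^+ 2 * k) * Z) -> c = 0.
Proof.
move=> Z0 k0 H; apply/eqP; rewrite -normr_eq0; apply/contraT => c0.
have {}c0 : 0 < `|c| by rewrite lt_neqAle eq_sym c0 normr_ge0.
have expB (y : R) : 0 <= y -> y <= 1 / 2 -> expR y <= 1 + 2 * y.
  move=> y0 y2; have := expR_ge1Dx (- y); rewrite expRN => h.
  have e0 := expR_gt0 y.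
  have : (1 - y) * expR y <= 1 by rewrite -ler_pdivlMr// div1r.
  nra.
have bound t : 0 < t -> t ^+ 2 * k <= 1 / 2 -> `|c| <= 2 * t * k * Z.
  move=> t0 tk; have sgc : Num.sg c * c = `|c| by rewrite -normrEsg.
  have := H (t * Num.sg c).
  have -> : (t * Num.sg c) ^+ 2 = t ^+ 2.
    by rewrite exprMn sqr_sg -normr_eq0 gt_eqF// mulr1.
  rewrite -(mulrA t) sgc => Hc.
  have tk0 : 0 <= t ^+ 2 * k by rewrite mulr_ge0// sqr_ge0.
  have : t * `|c| + Z <= (1 + 2 * (t ^+ 2 * k)) * Z.
    by apply: (le_trans Hc); apply: ler_wpM2r => //; exact: expB.
  by move=> h; rewrite -(ler_pM2l t0); lra.
(* The first bound makes t ^+ 2 * k <= 1 / 2; the second makes the upper bound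
   on `|c| at most `|c| / 2. *)
pose t := Num.min (1 / (2 * (1 + k))) (`|c| / (4 * (1 + k * Z))).
have kZ : 0 <= k * Z by rewrite mulr_ge0.
have t0 : 0 < t by rewrite lt_min !divr_gt0//; lra.
have t1 : t * (2 * (1 + k)) <= 1.
  by rewrite -ler_pdivlMr ?ge_min ?lexx//; lra.
have t2 : t * (4 * (1 + k * Z)) <= `|c|.
  by rewrite -ler_pdivlMr ?ge_min ?lexx ?orbT//; lra.
have := bound t t0.
have -> : t ^+ 2 * k <= 1 / 2 by nra.
move=> /(_ isT); nra.
Qed.

(** The density of N(m, A^-1) up to its normalizing constant; A is the
    precision matrix, so that kernels multiply by adding their matrices. *)
Definition gauss_kernel A m (x : 'cV[R]_d) : R := expR (- qform A (x - m) / 2).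

(** An exponential tilt only moves the centre of a Gaussian kernel. All the
    exponential moments therefore reduce to the total mass of a kernel. *)
Lemma gauss_kernel_tilt A m v (t : R) x : posdefmx A ->
  expR (t * dotmx (x - m) v) * gauss_kernel A m x =
  expR (t ^+ 2 * (qform (invmx A) v / 2)) *
    gauss_kernel A (m + t *: (invmx A *m v)) x.
Proof.
move=> Apd; have [As _] := Apd; have Au := posdefmx_unit Apd.
rewrite /gauss_kernel -!expRD; congr expR.
rewrite opprD addrA; set u := x - m; rewrite [in RHS]qformB// -scalemxAr mulKVmx// cdotZr.
rewrite (qformZ A) [qform A (invmx A *m v)]qformE mulKVmx// (cdotC (invmx A *m v)).
by rewrite -qformE; field.
Qed.

Lemma measurable_gauss_kernel A m : measurable_fun setT (gauss_kernel A m).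
Proof. exact: measurable_gauss_exp. Qed.

Lemma gauss_kernel_gt0 A m x : 0 < gauss_kernel A m x.
Proof. exact: expR_gt0. Qed.

Local Notation leb := (@lebesgue_cV R d).

Lemma integral_gauss_kernel A m : posdefmx A ->
  (\int[leb]_x (gauss_kernel A m x)%:E =
   (Num.sqrt ((2 * pi) ^+ d / \det A))%:E)%E.
Proof. by move=> /(gauss_mass m)[]. Qed.

Lemma integrable_gauss_kernel A m : posdefmx A ->
  leb.-integrable setT (fun x => (gauss_kernel A m x)%:E).
Proof.
move=> Apd; apply/integrableP; split.
  by apply/measurable_EFinP; exact: measurable_gauss_kernel.
under eq_integral do rewrite /= ger0_norm ?(ltW (gauss_kernel_gt0 _ _ _))//.
by rewrite integral_gauss_kernel// ltry.
Qed.

Lemma integrable_gauss_kernel_tilt A m v (t : R) : posdefmx A ->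
  leb.-integrable setT
    (fun x => (expR (t * dotmx (x - m) v) * gauss_kernel A m x)%:E).
Proof.
move=> Apd; under eq_fun do rewrite gauss_kernel_tilt// EFinM.
by apply: integrableZl => //; exact: integrable_gauss_kernel.
Qed.

(** A linear function y is dominated by exp y + exp (- y), that is, by two
    exponential tilts. *)
Lemma integrable_gauss_centered A m v : posdefmx A ->
  leb.-integrable setT (fun x => (dotmx (x - m) v * gauss_kernel A m x)%:E).
Proof.
move=> Apd; have := integrableD measurableT
  (integrable_gauss_kernel_tilt m v 1 Apd) (integrable_gauss_kernel_tilt m v (-1) Apd).
apply: le_integrable => //.
  apply/measurable_EFinP; apply: measurable_funM; last exact: measurable_gauss_kernel.
  under eq_fun do rewrite cdotDl.
  by apply: measurable_funD => //; exact: measurable_dotmxl.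
move=> x _; rewrite /= -mulrDl lee_fin !normrM ler_wpM2r// mul1r mulN1r.
set y := dotmx _ _; rewrite [leRHS]ger0_norm ?addr_ge0 ?expR_ge0//.
have e1 := expR_ge1Dx y; have e2 := expR_ge1Dx (- y).
have := expR_ge0 y; have := expR_ge0 (- y).
by rewrite ler_norml; lra.
Qed.

(** The inequality 1 + t y <= exp (t y), integrated over the kernel, bounds t
    times the integral of y by a quantity of order t^2, for both signs
    of t. *)
Lemma integral_gauss_centered A m v : posdefmx A ->
  (\int[leb]_x (dotmx (x - m) v * gauss_kernel A m x)%:E = 0)%E.
Proof.
move=> Apd; have ig := integrable_gauss_centered m v Apd.
have iE := integrable_gauss_kernel m Apd.
rewrite -[LHS]fineK ?(integrable_fin_num _ ig)//; congr EFin.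
set c := fine _.
have cE : (\int[leb]_x (dotmx (x - m) v * gauss_kernel A m x)%:E = c%:E)%E.
  by rewrite /c fineK ?(integrable_fin_num _ ig).
apply: (@eq0_of_exp_tangent _ (Num.sqrt ((2 * pi) ^+ d / \det A))
  (qform (invmx A) v / 2)).
- exact: sqrtr_ge0.
- by rewrite divr_ge0// qform_ge0//; exact: posdefmx_inv.
move=> t; rewrite -lee_fin EFinD !EFinM.
rewrite -(integral_gauss_kernel m Apd) -cE -integralZl//.
rewrite -integralD//; last exact: integrableZl.
apply: (@le_trans _ _ (\int[leb]_x
    (expR (t * dotmx (x - m) v) * gauss_kernel A m x)%:E)%E).
  apply: le_integral => //.
  - by apply: integrableD => //; exact: integrableZl.
  - exact: integrable_gauss_kernel_tilt.
  - move=> x _; rewrite -EFinM -EFinD lee_fin mulrA -[X in _ + X]mul1r -mulrDl.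
    by rewrite ler_wpM2r ?(ltW (gauss_kernel_gt0 _ _ _))// addrC expR_ge1Dx.
under eq_integral do rewrite gauss_kernel_tilt// EFinM.
rewrite (integralZl measurableT (integrable_gauss_kernel _ Apd)).
by rewrite !integral_gauss_kernel.
Qed.

Lemma gauss_mean A m v : posdefmx A ->
  leb.-integrable setT (fun x => (dotmx x v * gauss_kernel A m x)%:E) /\
  (\int[leb]_x (dotmx x v * gauss_kernel A m x)%:E =
   (dotmx m v)%:E * \int[leb]_x (gauss_kernel A m x)%:E)%E.
Proof.
move=> Apd; have ig := integrable_gauss_centered m v Apd.
have iE := integrable_gauss_kernel m Apd.
have sE x : (dotmx x v * gauss_kernel A m x)%:E =
    ((dotmx (x - m) v * gauss_kernel A m x)%:E +
     (dotmx m v)%:E * (gauss_kernel A m x)%:E)%E.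
  by rewrite -EFinM -EFinD -mulrDl -cdotDl subrK.
under eq_fun do rewrite sE.
split; first by apply: integrableD => //; exact: integrableZl.
rewrite integralD//; last exact: integrableZl.
by rewrite integral_gauss_centered// add0e integralZl.
Qed.

End gauss_mean.

(** * A nonnegative surrogate of the loss *)

Lemma compact_entry_bounded {R : realType} d (X : set 'cV[R]_d) : compact X ->
  exists C : R, forall x, X x -> forall i, `|x i 0| <= C.
Proof.
move=> /compact_bounded [M [_ HM]].
exists (M + 1) => x Xx i.
have Hx : `|x| <= M + 1 by apply: HM; rewrite ?ltrDl.
apply: le_trans Hx; rewrite [leRHS]mx_normrE.
exact: (le_bigmax _ (fun ij : 'I_d * 'I_1 => `|x ij.1 ij.2|) (i, 0)).
Qed.

Section shifted_loss.
Context {R : realType} {d : nat}.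
Implicit Types (m x : 'cV[R]_d).

Definition l1norm m : R := \sum_i `|m i 0|.

Lemma normr_dotmx_le (C : R) m x : (forall i, `|x i 0| <= C) ->
  `|dotmx m x| <= C * l1norm m.
Proof.
move=> xC; rewrite cdotE mulr_sumr; apply: le_trans (ler_norm_sum _ _ _) _.
by apply: ler_sum => i _; rewrite normrM mulrC ler_wpM2r.
Qed.

(** When C bounds the entries of the actions, this function is nonnegative, and
    it differs from the loss by a quantity that depends on m only. Such a shift
    leaves the comparison of rules unchanged, while every integral becomes one
    of a nonnegative function, jointly measurable in m and x; for the loss
    itself, joint measurability would require a study of the infimum. *)
Definition shifted_loss (C : R) m x : R := C * l1norm m + dotmx m x.

Lemma shifted_loss_ge0 C m x : (forall i, `|x i 0| <= C) -> 0 <= shifted_loss C m x.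
Proof. by move=> /(@normr_dotmx_le C m x); rewrite ler_norml /shifted_loss; lra. Qed.

Lemma shifted_loss_le C m x : (forall i, `|x i 0| <= C) ->
  shifted_loss C m x <= 2 * C * l1norm m.
Proof. by move=> /(@normr_dotmx_le C m x); rewrite ler_norml /shifted_loss; lra. Qed.

Lemma measurable_shifted_loss {d'} {T : measurableType d'} (C : R) (f g : T -> 'cV[R]_d) :
  measurable_fun setT f -> measurable_fun setT g ->
  measurable_fun setT (fun t => shifted_loss C (f t) (g t)).
Proof.
move=> mf mg; have me (h : T -> 'cV[R]_d) i :
    measurable_fun setT h -> measurable_fun setT (fun t => h t i 0).
  by move=> mh; exact: measurableT_comp (measurable_mxE i 0) mh.
apply: measurable_funD.
  apply: measurable_funM => //; apply: measurable_sum => i.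
  by apply: measurableT_comp => //; exact: me.
under eq_fun do rewrite cdotE.
by apply: measurable_sum => i; apply: measurable_funM; exact: me.
Qed.

End shifted_loss.

(** * Likelihood and posterior *)

Section likelihood.
Context {R : realType} {d n : nat}.
Implicit Types (S : 'M[R]_d) (m x : 'cV[R]_d) (xi : n.-tuple 'cV[R]_d).
Local Notation leb := (@lebesgue_cV R d).

Definition likelihood S m xi : R :=
  \prod_(i < n) gaussian_pdf m S (tnth xi i).

Lemma likelihood_ge0 S m xi : 0 <= likelihood S m xi.
Proof. by apply: prodr_ge0 => i _; exact: gaussian_pdf_ge0. Qed.

Lemma measurable_likelihood {d'} {T : measurableType d'} S
    (f : T -> 'cV[R]_d) (g : T -> n.-tuple 'cV[R]_d) :
  measurable_fun setT f -> measurable_fun setT g ->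
  measurable_fun setT (fun t => likelihood S (f t) (g t)).
Proof.
move=> mf mg; apply: measurable_prod => i _; apply: measurable_funM => //.
apply: measurableT_comp => //; apply: measurable_funM => //.
apply: measurableT_comp => //.
apply: (measurableT_comp (measurable_qform (invmx S))).
apply: measurable_fun_mxP => j k; under eq_fun do rewrite !mxE.
apply: measurable_funB.
  apply: (measurableT_comp (measurable_mxE j k)).
  exact: measurableT_comp (measurable_tnth i) mg.
exact: measurableT_comp (measurable_mxE j k) mf.
Qed.

Lemma ge0_integral_sample_law (f : n.-tuple 'cV[R]_d -> \bar R) m S :
  posdefmx S -> measurable_fun setT f -> (forall xi, 0 <= f xi)%E ->
  (\int[sample_law m S]_xi f xi =
   \int[prod_power leb n]_xi (f xi * (likelihood S m xi)%:E))%E.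
Proof.
move=> Spd mf f0.
apply: (ge0_integral_prod_power_density (lam := leb) (nu := gaussian_law m S)
  (p := gaussian_pdf m S)) => //.
- exact: measurable_gaussian_pdf.
- by move=> x; exact: gaussian_pdf_ge0.
- by move=> A mA; rewrite /= /gaussian_law asboolT.
Qed.

Lemma likelihoodE S m xi : likelihood S m xi =
  (Num.sqrt ((2 * pi) ^+ d * \det S))^-1 ^+ n *
  expR (- (\sum_(i < n) qform (invmx S) (tnth xi i - m)) / 2).
Proof.
rewrite /likelihood /gaussian_pdf big_split/= prodr_const card_ord; congr (_ * _).
by rewrite -expR_sum -mulr_suml sumrN.
Qed.

(** Conjugacy: multiplying the likelihood by the prior N(0, S / n) and completing
    the square in m gives a Gaussian shape centred at half the sample mean. The
    factor c, which depends on the sample only, is immaterial for the choice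
    of the best action. *)
Lemma posterior_kernel S xi : (0 < n)%N -> posdefmx S ->
  exists2 c : R, 0 <= c & forall m,
  likelihood S m xi * gauss_kernel (n%:R *: invmx S) 0 m =
  c * gauss_kernel (n.*2%:R *: invmx S) (2^-1 *: sample_mean xi) m.
Proof.
move=> n_gt0 Spd; have [As _] := posdefmx_inv Spd; set A := invmx S in As *.
set s := sample_mean xi.
exists ((Num.sqrt ((2 * pi) ^+ d * \det S))^-1 ^+ n *
  expR (- (\sum_(i < n) qform A (tnth xi i) - n%:R * qform A s / 2) / 2)).
  by rewrite mulr_ge0 ?expR_ge0// exprn_ge0// invr_ge0 sqrtr_ge0.
move=> m; rewrite likelihoodE -/A /gauss_kernel -!mulrA -!expRD.
congr (_ * expR _); rewrite !qformZl subr0 (qformB m)//.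
rewrite (qformZ A 2^-1 s) -scalemxAr cdotZr.
have -> : \sum_(i < n) qform A (tnth xi i - m) =
    \sum_(i < n) qform A (tnth xi i) + n%:R * qform A m -
    2 * (n%:R * dotmx m (A *m s)).
  under eq_bigr do rewrite qformB//.
  rewrite !big_split/= sumrN sumr_const card_ord -[_ *+ n]mulr_natl.
  congr (_ - _); rewrite -mulr_sumr -cdotZr; congr (2 * _).
  rewrite scalemxAr /s /sample_mean scalerA divff ?pnatr_eq0 -?lt0n// scale1r.
  rewrite mulmx_sumr /dotmx mulmx_sumr summxE.
  by apply: eq_bigr => i _; rewrite -[LHS]/(dotmx _ _) cdotC cdot_mull.
by rewrite -mul2n natrM; field.
Qed.

End likelihood.

(** * Bayes risk *)

Section bayes.
Context {R : realType} {d n : nat}.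
Variables (X : set 'cV[R]_d) (C : R) (S : 'M[R]_d).
Hypothesis X_nonempty : X !=set0.
Hypothesis X_bounded : forall x, X x -> forall i, `|x i 0| <= C.
Hypothesis Spd : posdefmx S.
Implicit Types (m x : 'cV[R]_d) (xi : n.-tuple 'cV[R]_d).
Implicit Types delta : n.-tuple 'cV[R]_d -> 'cV[R]_d.
Local Notation leb := (@lebesgue_cV R d).

Definition shifted_risk m delta : \bar R :=
  (\int[sample_law m S]_xi (shifted_loss C m (delta xi))%:E)%E.

Lemma integral_sample_law_cst m (k : R) :
  (\int[@sample_law R d n m S]_xi k%:E = k%:E)%E.
Proof.
rewrite integral_cst//; transitivity (k%:E * 1)%E; last by rewrite mule1.
by congr (_ * _)%E; exact: probability_setT.
Qed.

(** The two risks differ by a real number common to all the rules, so they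
    induce the same order on the rules in each state. *)
Lemma shifted_riskE m delta : decision_rule X delta ->
  shifted_risk m delta = (risk X S m delta +
    (C * l1norm m + inf [set dotmx m z | z in X])%:E)%E.
Proof.
move=> [mdelta Xdelta]; set I := inf _.
have lbX x : X x -> - (C * l1norm m) <= dotmx m x.
  by move=> /X_bounded/(@normr_dotmx_le _ _ _ m); rewrite ler_norml => /andP[].
have lbI : lbound [set dotmx m z | z in X] (- (C * l1norm m)).
  by move=> _ [x Xx <-]; exact: lbX.
have I_ge : 0 <= C * l1norm m + I.
  rewrite addrC -lerBlDr sub0r; apply: lb_le_inf => //.
  by have [x Xx] := X_nonempty; exists (dotmx m x), x.
have I_le x : X x -> I <= dotmx m x.
  by move=> Xx; apply: ge_inf; [exists (- (C * l1norm m))|exists x].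
rewrite /shifted_risk /risk unlock.
under eq_integral => xi _.
  rewrite (_ : shifted_loss C m (delta xi) =
    loss X m (delta xi) + (C * l1norm m + I)); last first.
    by rewrite /shifted_loss /loss -/I; ring.
  rewrite EFinD; over.
rewrite ge0_integralD//.
- by rewrite integral_sample_law_cst.
- by move=> xi _; rewrite lee_fin subr_ge0 I_le.
- apply/measurable_EFinP; apply: measurable_funB => //.
  under eq_fun do rewrite cdotC.
  exact: measurableT_comp (measurable_dotmxl m) mdelta.
Qed.

Let loss_ge0 delta m xi : decision_rule X delta ->
  0 <= shifted_loss C m (delta xi).
Proof. by move=> [_ Xdelta]; apply: shifted_loss_ge0; exact/X_bounded. Qed.

Let measurable_loss delta m : decision_rule X delta ->
  measurable_fun setT (fun xi => shifted_loss C m (delta xi)).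
Proof. by move=> [mdelta _]; exact: measurable_shifted_loss. Qed.

Lemma shifted_risk_ge0 m delta : decision_rule X delta ->
  (0 <= shifted_risk m delta)%E.
Proof. by move=> dd; apply: integral_ge0 => xi _; rewrite lee_fin loss_ge0. Qed.

Lemma shifted_risk_le m delta : decision_rule X delta ->
  (shifted_risk m delta <= (2 * C * l1norm m)%:E)%E.
Proof.
move=> dd.
apply: (@le_trans _ _ (\int[sample_law m S]_xi (2 * C * l1norm m)%:E)%E).
  apply: ge0_le_integral => //.
  - by move=> xi _; rewrite lee_fin loss_ge0.
  - by apply/measurable_EFinP; exact: measurable_loss.
  - move=> xi _; rewrite lee_fin shifted_loss_le// => i.
    by apply: X_bounded; case: dd.
by rewrite integral_sample_law_cst.
Qed.

Lemma shifted_risk_fin_num m delta : decision_rule X delta ->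
  shifted_risk m delta \is a fin_num.
Proof.
move=> dd; rewrite ge0_fin_numE ?shifted_risk_ge0//.
by rewrite (le_lt_trans (shifted_risk_le m dd))// ltry.
Qed.

Lemma shifted_risk_likelihood m delta : decision_rule X delta ->
  shifted_risk m delta = (\int[prod_power leb n]_xi
    (shifted_loss C m (delta xi) * likelihood S m xi)%:E)%E.
Proof.
move=> dd; rewrite /shifted_risk ge0_integral_sample_law//.
- by apply/measurable_EFinP; exact: measurable_loss.
- by move=> xi; rewrite lee_fin loss_ge0.
Qed.

(** The prior N(0, S / n), not normalized, charges every open set: this is what
    makes a Bayes rule for it admissible. *)
Let prior m : R := gauss_kernel (n%:R *: invmx S) 0 m.

Definition bayes_risk delta : \bar R :=
  (\int[leb]_m (shifted_risk m delta * (prior m)%:E))%E.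

Let joint delta (z : 'cV[R]_d * n.-tuple 'cV[R]_d) : \bar R :=
  (shifted_loss C z.1 (delta z.2) * (likelihood S z.1 z.2 * prior z.1))%:E.

Let joint_ge0 delta z : decision_rule X delta -> (0 <= joint delta z)%E.
Proof.
move=> dd; rewrite lee_fin mulr_ge0 ?loss_ge0// mulr_ge0 ?likelihood_ge0//.
exact/ltW/gauss_kernel_gt0.
Qed.

Let measurable_joint delta : decision_rule X delta ->
  measurable_fun setT (joint delta).
Proof.
move=> [mdelta _]; apply/measurable_EFinP; apply: measurable_funM.
  apply: measurable_shifted_loss; first exact: measurable_fst.
  exact: measurableT_comp mdelta measurable_snd.
apply: measurable_funM.
  by apply: measurable_likelihood; [exact: measurable_fst|exact: measurable_snd].
exact: measurableT_comp (measurable_gauss_kernel _ _) measurable_fst.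
Qed.

Let shifted_risk_prior m delta : decision_rule X delta ->
  (shifted_risk m delta * (prior m)%:E =
   fubini_F (prod_power leb n) (joint delta) m)%E.
Proof.
move=> dd; rewrite shifted_risk_likelihood// -ge0_integralZr//.
- by apply: eq_integral => xi _; rewrite /joint -EFinM -mulrA.
- apply/measurable_EFinP; apply: measurable_funM.
    exact: measurable_loss.
  exact: measurable_likelihood.
- by move=> xi _; rewrite lee_fin mulr_ge0 ?loss_ge0 ?likelihood_ge0.
- by rewrite lee_fin; exact/ltW/gauss_kernel_gt0.
Qed.

Lemma bayes_risk_tonelli delta : decision_rule X delta ->
  bayes_risk delta = (\int[prod_power leb n]_xi \int[leb]_m
    (shifted_loss C m (delta xi) * (likelihood S m xi * prior m))%:E)%E.
Proof.
move=> dd; rewrite /bayes_risk.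
under eq_integral do rewrite shifted_risk_prior//.
rewrite -(@fubini_tonelli1 _ _ _ _ _ leb (prod_power leb n) (joint delta))//.
- rewrite (@fubini_tonelli2 _ _ _ _ _ leb (prod_power leb n) (joint delta))//.
    exact: measurable_joint.
  by move=> z; exact: joint_ge0.
- exact: measurable_joint.
- by move=> z; exact: joint_ge0.
Qed.

Lemma measurable_shifted_risk_prior delta : decision_rule X delta ->
  measurable_fun setT (fun m => shifted_risk m delta * (prior m)%:E)%E.
Proof.
move=> dd; under eq_fun do rewrite shifted_risk_prior//.
apply: (@measurable_fun_fubini_tonelli_F _ _ _ _ _ (prod_power leb n) (joint delta)).
  exact: measurable_joint.
by move=> z; exact: joint_ge0.
Qed.

Lemma integrable_l1norm_gauss_kernel (A : 'M[R]_d) c : posdefmx A ->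
  leb.-integrable setT (fun m => (l1norm m * gauss_kernel A c m)%:E).
Proof.
move=> Apd.
have cE m i : m i 0 = dotmx m (delta_mx i 0).
  rewrite cdotE (bigD1 i)//= big1 ?addr0 => [|j ji]; rewrite !mxE ?eqxx ?mulr1//.
  by rewrite (negbTE ji) mulr0.
rewrite (_ : (fun _ => _) = (fun m =>
    \sum_(i < d) (abse \o
      (fun m => (dotmx m (delta_mx i 0) * gauss_kernel A c m)%:E)) m)%E).
  apply: integrable_sum => // i _; apply: integrable_abse.
  by have [] := gauss_mean c (delta_mx i 0) Apd.
apply/funext => m; rewrite /= sumEFin mulr_suml; congr EFin.
apply: eq_bigr => i _; by rewrite -cE normrM (ger0_norm (ltW (gauss_kernel_gt0 _ _ _))).
Qed.

(** Under a Gaussian kernel the action x enters the expected loss only through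
    its inner product with the centre c. *)
Lemma integral_shifted_loss_gauss (A : 'M[R]_d) c x : posdefmx A ->
  leb.-integrable setT (fun m => (shifted_loss C m x * gauss_kernel A c m)%:E) /\
  (\int[leb]_m (shifted_loss C m x * gauss_kernel A c m)%:E =
   C%:E * \int[leb]_m (l1norm m * gauss_kernel A c m)%:E +
   (dotmx c x)%:E * \int[leb]_m (gauss_kernel A c m)%:E)%E.
Proof.
move=> Apd; have [i1 <-] := gauss_mean c x Apd.
have i2 := integrable_l1norm_gauss_kernel c Apd.
have sE m : (shifted_loss C m x * gauss_kernel A c m)%:E =
   (C%:E * (l1norm m * gauss_kernel A c m)%:E + (dotmx m x * gauss_kernel A c m)%:E)%E.
  by rewrite -EFinM -EFinD mulrA -mulrDl.
under eq_fun do rewrite sE.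
split; first by apply: integrableD => //; exact: integrableZl.
by rewrite integralD// ?integralZl//; exact: integrableZl.
Qed.

Lemma bayes_risk_lty delta : (0 < n)%N -> decision_rule X delta ->
  (bayes_risk delta < +oo)%E.
Proof.
move=> n0 dd; have Apd : posdefmx (n%:R *: invmx S).
  by apply: posdefmxZ; [rewrite ltr0n|exact: posdefmx_inv].
have /(integrableZl measurableT (2 * C)) H := integrable_l1norm_gauss_kernel 0 Apd.
have := integrable_lty measurableT H; apply: le_lt_trans.
apply: ge0_le_integral => //.
- move=> m _; rewrite mule_ge0 ?shifted_risk_ge0// lee_fin.
  exact/ltW/gauss_kernel_gt0.
- exact: measurable_shifted_risk_prior.
- by case/integrableP : H.
- move=> m _; rewrite -EFinM mulrA EFinM lee_wpmul2r//.
    by rewrite lee_fin; exact/ltW/gauss_kernel_gt0.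
  exact: shifted_risk_le.
Qed.

(** By Tonelli the Bayes risk is minimized sample by sample. Given the sample,
    the posterior mean is a positive multiple of the sample mean, so the action
    that is best on average over the posterior is the one that the sample
    average rule selects. *)
Lemma bayes_risk_sample_average delta delta' : (0 < n)%N ->
  sample_average_rule X delta -> decision_rule X delta' ->
  (bayes_risk delta <= bayes_risk delta')%E.
Proof.
move=> n0 [dd SA] dd'; rewrite (bayes_risk_tonelli dd) (bayes_risk_tonelli dd').
have m2 delta0 (d0 : decision_rule X delta0) :=
  @measurable_fun_fubini_tonelli_G _ _ _ _ _ leb _ (measurable_joint d0)
    (fun z => joint_ge0 z d0).
apply: ge0_le_integral => //.
- by move=> xi _; apply: integral_ge0 => m _; exact: (joint_ge0 (m, xi)).
- exact: m2.
- exact: m2.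
move=> xi _; have [c c0 cE] := posterior_kernel xi n0 Spd.
set A := n.*2%:R *: invmx S in cE; set s := 2^-1 *: sample_mean xi in cE.
have Apd : posdefmx A.
  by apply: posdefmxZ; [rewrite ltr0n double_gt0|exact: posdefmx_inv].
(* Up to the factor c, the inner integral is an expectation under the
   posterior. *)
have cK x : (\int[leb]_m (shifted_loss C m x * (likelihood S m xi * prior m))%:E =
    c%:E * \int[leb]_m (shifted_loss C m x * gauss_kernel A s m)%:E)%E.
  have [iK _] := integral_shifted_loss_gauss s x Apd.
  rewrite -(integralZl measurableT iK).
  by apply: eq_integral => m _; rewrite -EFinM cE mulrCA.
rewrite !cK lee_wpmul2l ?lee_fin//.
rewrite (integral_shifted_loss_gauss s (delta xi) Apd).2.
rewrite (integral_shifted_loss_gauss s (delta' xi) Apd).2.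
rewrite leeD2l// lee_wpmul2r//.
  by apply: integral_ge0 => m _; rewrite lee_fin; exact/ltW/gauss_kernel_gt0.
rewrite lee_fin !(cdotZl 2^-1) ler_wpM2l ?invr_ge0//.
by have [_ SAxi] := SA xi; apply: SAxi; exact: dd'.2.
Qed.

Lemma shifted_risk_ae_eq delta delta' : (0 < n)%N ->
  sample_average_rule X delta -> decision_rule X delta' ->
  (forall m, shifted_risk m delta' <= shifted_risk m delta)%E ->
  {ae leb, forall m, shifted_risk m delta' = shifted_risk m delta}.
Proof.
move=> n0 SA dd' le; have [dd _] := SA.
have p0 m : 0 < prior m by exact: gauss_kernel_gt0.
have : {ae leb, forall m, shifted_risk m delta' * (prior m)%:E =
    shifted_risk m delta * (prior m)%:E}%E.
  apply: ae_eq_of_le_integral.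
  - exact: measurable_shifted_risk_prior.
  - exact: measurable_shifted_risk_prior.
  - by move=> m; rewrite mule_ge0 ?shifted_risk_ge0// lee_fin ltW.
  - by move=> m; rewrite lee_wpmul2r// lee_fin ltW.
  - by move=> m; rewrite fin_numM// shifted_risk_fin_num.
  - exact: bayes_risk_sample_average.
  - exact: bayes_risk_lty.
apply: filterS => m.
rewrite -(fineK (shifted_risk_fin_num m dd)) -(fineK (shifted_risk_fin_num m dd')).
rewrite -!EFinM => -[] /mulIf -> //; exact/lt0r_neq0.
Qed.

End bayes.

(** * Continuity of the risk in the state *)

Section entrywise_limits.
Context {R : realType} {d n : nat}.
Variables (m_ : nat -> 'cV[R]_d) (m : 'cV[R]_d).
Hypothesis m_cvg : forall i, m_ k i 0 @[k --> \oo] --> m i 0.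

Lemma cvg_sum_ord (I : finType) (f : I -> nat -> R) (l : I -> R) :
  (forall i, f i k @[k --> \oo] --> l i) ->
  \sum_i f i k @[k --> \oo] --> \sum_i l i.
Proof. by move=> fl; apply: cvg_big => //; exact: add_continuous. Qed.

Lemma cvg_l1norm : l1norm (m_ k) @[k --> \oo] --> l1norm m.
Proof. by apply: cvg_sum_ord => i; exact: cvg_norm. Qed.

Lemma cvg_shifted_loss C x :
  shifted_loss C (m_ k) x @[k --> \oo] --> shifted_loss C m x.
Proof.
apply: cvgD; first by apply: cvgM; [exact: cvg_cst|exact: cvg_l1norm].
under eq_fun do rewrite cdotE; rewrite cdotE.
by apply: cvg_sum_ord => i; apply: cvgM => //; exact: cvg_cst.
Qed.

Lemma cvg_qformB (A : 'M[R]_d) x :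
  qform A (x - m_ k) @[k --> \oo] --> qform A (x - m).
Proof.
under eq_fun do rewrite qformE cdotE; rewrite qformE cdotE.
have xm i : (x - m_ k) i 0 @[k --> \oo] --> (x - m) i 0.
  under eq_fun do rewrite !mxE; rewrite !mxE.
  by apply: cvgB => //; exact: cvg_cst.
apply: cvg_sum_ord => i; apply: cvgM => //.
under eq_fun do rewrite mxE; rewrite mxE.
by apply: cvg_sum_ord => j; apply: cvgM => //; exact: cvg_cst.
Qed.

Lemma cvg_expR (f : nat -> R) l : f k @[k --> \oo] --> l ->
  expR (f k) @[k --> \oo] --> expR l.
Proof. by move=> fl; apply: continuous_cvg => //; exact: continuous_expR. Qed.

Lemma cvg_likelihood (S : 'M[R]_d) (xi : n.-tuple 'cV[R]_d) :
  likelihood S (m_ k) xi @[k --> \oo] --> likelihood S m xi.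
Proof.
apply: cvg_big => [|i _]; first exact: mul_continuous.
apply: cvgM; first exact: cvg_cst.
apply: cvg_expR; apply: cvgM; last exact: cvg_cst.
by apply: cvgN; exact: cvg_qformB.
Qed.

End entrywise_limits.

Section domination.
Context {R : realType} {d n : nat}.

(** Doubling the covariance absorbs a shift of the mean: q(x) <= 2 q(x - m) +
    2 q(m) for a positive semidefinite form q. This gives a dominating
    function that is uniform in m on bounded sets, and is itself a multiple of
    a Gaussian density. *)
Lemma gaussian_pdf_le (S : 'M[R]_d) : posdefmx S -> exists2 a : R, 0 <= a &
  forall m x, gaussian_pdf m S x <=
    a * expR (qform (invmx S) m / 2) * gaussian_pdf 0 (2 *: S) x.
Proof.
move=> Spd; have Apd := posdefmx_inv Spd; have [As _] := Apd.
have S2pd : posdefmx (2 *: S) by exact: posdefmxZ.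
have D2 : 0 < Num.sqrt ((2 * pi) ^+ d * \det (2 *: S)).
  have [S0 _] := gauss_mass 0 S2pd.
  by rewrite sqrtr_gt0 mulr_gt0// exprn_gt0// mulr_gt0// pi_gt0.
exists ((Num.sqrt ((2 * pi) ^+ d * \det S))^-1 *
    Num.sqrt ((2 * pi) ^+ d * \det (2 *: S))).
  by rewrite mulr_ge0 ?invr_ge0 ?sqrtr_ge0.
move=> m x; rewrite /gaussian_pdf.
set D := Num.sqrt _ in D2 *; set D' := (Num.sqrt _)^-1.
rewrite mulrACA -!mulrA mulVKf ?gt_eqF// -expRD.
rewrite ler_wpM2l ?invr_ge0 ?sqrtr_ge0// ler_expR.
rewrite invmxZ ?posdefmx_unit// qformZl subr0.
(* 2 q(x - m) + 2 q(m) - q(x) = q(x - 2 m) *)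
have := qform_ge0 (x - 2 *: m) Apd.
rewrite !qformB// qformZ -scalemxAr cdotZr; lra.
Qed.

Lemma likelihood_le (S : 'M[R]_d) : posdefmx S -> exists2 a : R, 0 <= a &
  forall m (xi : n.-tuple 'cV[R]_d), likelihood S m xi <=
    (a * expR (qform (invmx S) m / 2)) ^+ n * likelihood (2 *: S) 0 xi.
Proof.
move=> /gaussian_pdf_le[a a0 pdf_le]; exists a => // m xi.
rewrite -[X in _ ^+ X]card_ord -prodr_const -big_split/=.
by apply: ler_prod => i _; rewrite gaussian_pdf_ge0 pdf_le.
Qed.

End domination.

Section continuity.
Context {R : realType} {d n : nat}.
Variables (X : set 'cV[R]_d) (C : R) (S : 'M[R]_d).
Hypothesis X_bounded : forall x, X x -> forall i, `|x i 0| <= C.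
Hypothesis Spd : posdefmx S.
Variable delta : n.-tuple 'cV[R]_d -> 'cV[R]_d.
Hypothesis dd : decision_rule X delta.
Local Notation leb := (@lebesgue_cV R d).

(** Dominated convergence; the likelihoods in the states m_ k are all at most
    a multiple of the likelihood in state 0 with covariance 2 S, because the
    multiples converge, hence are bounded. *)
Lemma cvg_shifted_risk (m_ : nat -> 'cV[R]_d) (m : 'cV[R]_d) :
  (forall i, m_ k i 0 @[k --> \oo] --> m i 0) ->
  shifted_risk C S (m_ k) delta @[k --> \oo] --> shifted_risk C S m delta.
Proof.
move=> m_cvg; have [mdelta Xdelta] := dd.
under eq_fun do rewrite (shifted_risk_likelihood X_bounded Spd _ dd).
rewrite (shifted_risk_likelihood X_bounded Spd _ dd).
have [a a0 lik_le] := @likelihood_le R d n S Spd.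
pose b k := 2 * C * l1norm (m_ k) * (a * expR (qform (invmx S) (m_ k) / 2)) ^+ n.
have [M bM] : exists M, forall k, b k <= M.
  have : cvgn b.
    apply/cvg_ex; exists (2 * C * l1norm m *
      (a * expR (qform (invmx S) m / 2)) ^+ n).
    have qm : qform (invmx S) (m_ k) @[k --> \oo] --> qform (invmx S) m.
      rewrite -[in X in _ --> X]qformN -[- m]add0r.
      under eq_fun do rewrite -qformN -[- m_ _]add0r.
      exact: cvg_qformB.
    apply: cvgM; first by apply: cvgM; [exact: cvg_cst|exact: cvg_l1norm].
    have em : a * expR (qform (invmx S) (m_ k) / 2) @[k --> \oo] -->
        a * expR (qform (invmx S) m / 2).
      apply: cvgM; first exact: cvg_cst.
      by apply: cvg_expR; apply: cvgM => //; exact: cvg_cst.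
    exact: (cvg_comp _ _ em (@exprn_continuous _ n _)).
  move=> /cvg_seq_bounded[M [_ HM]]; exists (M + 1) => k.
  by apply: le_trans (ler_norm _) _; apply: HM => //; rewrite ltrDl.
have mlik S' m' : measurable_fun setT (fun xi : n.-tuple 'cV[R]_d => likelihood S' m' xi).
  exact: measurable_likelihood.
have mf m' : measurable_fun setT (fun xi : n.-tuple 'cV[R]_d =>
    (shifted_loss C m' (delta xi) * likelihood S m' xi)%:E).
  apply/measurable_EFinP; apply: measurable_funM => //.
  exact: measurable_shifted_loss.
have S2pd : posdefmx (2 *: S) by exact: posdefmxZ.
have [] // := @dominated_convergence _ _ R (prod_power leb n) setT measurableT
  (fun k xi => (shifted_loss C (m_ k) (delta xi) * likelihood S (m_ k) xi)%:E)
  (fun xi => (shifted_loss C m (delta xi) * likelihood S m xi)%:E)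
  (fun xi => (M * likelihood (2 *: S) 0 xi)%:E).
- apply: aeW => xi _; apply: cvg_EFin; first by apply: nearW.
  by apply: cvgM; [exact: cvg_shifted_loss|exact: cvg_likelihood].
- under eq_fun do rewrite EFinM.
  apply: integrableZl => //; apply/integrableP; split.
    exact/measurable_EFinP.
  under eq_integral do rewrite gee0_abs ?lee_fin ?likelihood_ge0//.
  rewrite (_ : (\int[_]_x _)%E = (\int[@sample_law R d n 0 (2 *: S)]_xi 1)%E).
    by rewrite integral_sample_law_cst ltry.
  rewrite ge0_integral_sample_law//.
  by apply: eq_integral => xi _; rewrite mul1e.
- apply: aeW => xi k _; rewrite /= lee_fin normrM.
  rewrite !ger0_norm ?likelihood_ge0//; last first.
    by apply: shifted_loss_ge0; exact/X_bounded.
  apply: (@le_trans _ _ (b k * likelihood (2 *: S) 0 xi)); last first.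
    by rewrite ler_wpM2r ?likelihood_ge0.
  rewrite /b -mulrA ler_pM ?likelihood_ge0//.
    by apply: shifted_loss_ge0; exact/X_bounded.
  by apply: shifted_loss_le; exact/X_bounded.
Qed.

End continuity.

(** * Admissibility *)

Lemma lebesgue_cV_box_gt0 {R : realType} d (c : 'cV[R]_d) (e : R) : 0 < e ->
  (0 < @lebesgue_cV R d [set m : 'cV[R]_d | forall i, ball (c i 0%R) e (m i 0%R)])%E.
Proof.
move=> e0; rewrite /lebesgue_cV /pushforward.
rewrite (_ : _ @^-1` _ = [set t | forall i, ball (c i 0) e (tnth t i)]).
  apply: (@prod_power_box_gt0 _ (measurableTypeR R) R lebesgue_measure d
    (fun i => ball (c i 0) e)) => i.
    exact: measurable_ball.
  suff : (0 < lebesgue_measure (ball (c i 0%R) e))%E by [].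
  by rewrite lebesgue_measure_ball ?ltW// lte_fin mulrn_wgt0.
by apply/seteqP; split => t /= H i; have := H i; rewrite mxE.
Qed.

(** Every ball has positive Lebesgue measure, so it contains a point at which a
    property true almost everywhere holds; shrink the ball. *)
Lemma ae_lebesgue_cV_dense {R : realType} d (P : 'cV[R]_d -> Prop) :
  {ae @lebesgue_cV R d, forall m, P m} -> forall c : 'cV[R]_d,
  exists m_ : nat -> 'cV[R]_d,
    (forall i, m_ k i 0 @[k --> \oo] --> c i 0) /\ forall k, P (m_ k).
Proof.
move=> [N [mN N0 PN]] c.
have near_c (k : nat) : exists m : 'cV[R]_d,
    (forall i, ball (c i 0) k.+1%:R^-1 (m i 0)) /\ P m.
  apply: contrapT => none.
  have := @lebesgue_cV_box_gt0 R d c k.+1%:R^-1; rewrite invr_gt0 ltr0n => /(_ isT).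
  apply/negP; rewrite -leNgt -N0; apply: le_measure; rewrite ?inE//.
    rewrite (_ : [set _ | _] = \bigcap_(i in [set: 'I_d])
        ((fun m : 'cV[R]_d => m i 0) @^-1` ball (c i 0) k.+1%:R^-1)).
      apply: fin_bigcap_measurable => // i _.
      rewrite -[X in measurable X]setTI; apply: measurable_mxE => //.
      exact: measurable_ball.
    by apply/seteqP; split => m /= H i; [move=> _|]; exact: H.
  by move=> m box; apply: PN => Pm; apply: none; exists m.
have [m_ m_P] := choice near_c.
exists m_; split=> [i|k]; last by case: (m_P k).
apply/cvg_ballP => e e0; have := near_infty_natSinv_lt (PosNum e0).
by apply: filterS => k /ltW ke; apply: le_ball ke _ _; exact: (m_P k).1.
Qed.

Theorem theorem1p1 (R : realType) (d n : nat) (hd : (1 <= d)%N) (hn : (1 <= n)%N)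
  (X : set 'cV[R]_d) (X_nonempty : X !=set0) (X_compact : compact X)
  (Sigma : 'M[R]_d) (Sigma_posdef : posdefmx Sigma)
  (delta : n.-tuple 'cV[R]_d -> 'cV[R]_d)
  (delta_SA : sample_average_rule X delta) :
  admissible X Sigma delta.
Proof.
move=> [delta' [[dd' _] [risk_le [m risk_lt]]]].
have [dd _] := delta_SA.
have [C XC] := compact_entry_bounded X_compact.
have le m' : (shifted_risk C Sigma m' delta' <= shifted_risk C Sigma m' delta)%E.
  rewrite (shifted_riskE Sigma X_nonempty XC _ dd').
  rewrite (shifted_riskE Sigma X_nonempty XC _ dd).
  by rewrite leeD2r.
have [m_ [m_cvg eq_m]] := ae_lebesgue_cV_dense
  (shifted_risk_ae_eq XC Sigma_posdef hn delta_SA dd' le) m.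
have : shifted_risk C Sigma m delta' = shifted_risk C Sigma m delta.
  have c' := cvg_shifted_risk XC Sigma_posdef dd' m_cvg.
  have c := cvg_shifted_risk XC Sigma_posdef dd m_cvg.
  rewrite -(cvg_lim (@ereal_hausdorff R) c') -(cvg_lim (@ereal_hausdorff R) c).
  congr (lim (_ @ \oo)).
  by apply/funext => k; exact: eq_m.
apply/eqP; rewrite lt_eqF//.
rewrite (shifted_riskE Sigma X_nonempty XC _ dd').
rewrite (shifted_riskE Sigma X_nonempty XC _ dd).
by rewrite lteD2rE.
Qed.
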